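(* Let $\hat f$ be a discrete maximal surface in $\mathbb{R}^{2,1}$ with associated discrete holomorphic function $g$, as described in the context. Let $p_-$, $p$ and $p_+$ be three consecutive vertices in one direction in the lattice domain of $\hat f$, and suppose $p$ is an FPS vertex. Then the pair of faces adjacent to the edge $p_-p$ are singular, or the pair of faces adjacent to the edge $pp_+$ are singular, including the possibility that all four faces are singular.
   Context: $\mathbb{R}^{2,1}$ is Minkowski 3-space with coordinates $(x_1,x_2,x_0)$ and metric of signature $(+,+,-)$. A plane with normal vector $\nu\neq0$ is spacelike if $\nu$ is timelike, timelike if $\nu$ is spacelike, lightlike if $\nu$ is lightlike. The lattice domain is $\mathbb{Z}^2$ or some subdomain of it. A quadrilateral (face) has vertices $i=(m,n)$, $j=(m+1,n)$, $k=(m+1,n+1)$, $\ell=(m,n+1)$. A discrete holomorphic function is a complex-valued function $g$ on the lattice domain with $$\frac{(g_i-g_j)(g_k-g_\ell)}{(g_j-g_k)(g_\ell-g_i)}=\frac{\alpha_{ij}}{\alpha_{i\ell}}<0$$ on all quadrilaterals, where the real-valued cross ratio factorizing function $\alpha$ on edges satisfies $\alpha_{ij}=\alpha_{\ell k}$, $\alpha_{i\ell}=\alpha_{jk}$; it is assumed that $dg_{i*}=g_*-g_i\neq0$ on all edges. The discrete maximal surface $\hat f$ (a discrete surface with discrete mean curvature identically $0$) determined by $g$ satisfies, for $*=j,\ell$, $$\hat f_*-\hat f_i=\frac{\alpha_{i*}}{2}\,\mathrm{Re}\left(\frac{1+g_*g_i}{g_*-g_i},\ \frac{\sqrt{-1}\,(1-g_*g_i)}{g_*-g_i},\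 -\frac{g_*+g_i}{g_*-g_i}\right)^{t}.$$ The principal curvatures of $\hat f$, defined on edges, are $$\kappa_{i*}=-\frac{4|dg_{i*}|^2}{\alpha_{i*}(1-|g_i|^2)(1-|g_*|^2)}.$$ A vertex $(m,n)$ is a flat-or-parabolic-or-singular (FPS) vertex if $$\kappa_{(m-1,n),(m,n)}\cdot\kappa_{(m,n),(m+1,n)}\le0\quad\text{or}\quad\kappa_{(m,n-1),(m,n)}\cdot\kappa_{(m,n),(m,n+1)}\le0.$$ A face of $\hat f$ with vertices $\hat f_i,\hat f_j,\hat f_k,\hat f_\ell$ is singular if those four vertices lie in a non-spacelike plane.
   Formalization: The three consecutive vertices are taken in a direction along which the FPS curvature inequality holds at p; if p is FPS only because of the other direction, the claim can fail (e.g. g = -0.9+0.2(m+in) at (0,0), vertical direction). *)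

(* Defs.v *)
From HB Require Import structures.
From mathcomp Require Import all_boot all_order all_algebra.
From mathcomp Require Import classical_sets reals.
From mathcomp Require Import complex.

Set Implicit Arguments.
Unset Strict Implicit.
Unset Printing Implicit Defensive.

Import Order.TTheory GRing.Theory Num.Theory.

Local Open Scope ring_scope.
Local Open Scope complex_scope.

Notation modulus := ComplexField.Normc.normc.
Notation real_part := complex.Re.

(* Coordinates 0, 1, 2 of a row vector are x_1, x_2, x_0 (time last). *)
Definition minkowski (R : realType) (u v : 'rV[R]_3) : R :=
  u 0 0 * v 0 0 + u 0 1 * v 0 1 - u 0 2 * v 0 2.

Definition timelike (R : realType) (v : 'rV[R]_3) : Prop := minkowski v v < 0.

Record plane (R : realType) := Plane {
  normal : 'rV[R]_3;
  offset : R;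
  normal_neq0 : normal != 0 }.

Definition on_plane (R : realType) (P : plane R) (x : 'rV[R]_3) : Prop :=
  minkowski x (normal P) = offset P.

Definition spacelike_plane (R : realType) (P : plane R) : Prop :=
  timelike (normal P).

Notation lattice := (int * int)%type.

Variant direction := Horizontal | Vertical.

Definition transverse (d : direction) : direction :=
  if d is Horizontal then Vertical else Horizontal.

Definition step (d : direction) : lattice :=
  if d is Horizontal then (1, 0) else (0, 1).

(* The edges of the lattice are the pairs (i, i + step d), so a function
   [alpha : lattice -> lattice -> R] on edges is only ever evaluated with its
   arguments in increasing order. *)
Definition edge_in (D : set lattice) (d : direction) (i : lattice) : Prop :=
  D i /\ D (i + step d).

(* A face is named by its lower left vertex i; the other ones are: *)
Definition vj (i : lattice) : lattice := i + step Horizontal.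
Definition vk (i : lattice) : lattice := i + step Horizontal + step Vertical.
Definition vl (i : lattice) : lattice := i + step Vertical.

Definition face_in (D : set lattice) (i : lattice) : Prop :=
  [/\ D i, D (vj i), D (vk i) & D (vl i)].

Definition cross_ratio (R : realType) (a b c d : R[i]) : R[i] :=
  ((a - b) * (c - d)) / ((b - c) * (d - a)).

Definition discrete_holomorphic (R : realType) (D : set lattice)
    (alpha : lattice -> lattice -> R) (g : lattice -> R[i]) : Prop :=
  (forall d i, edge_in D d i -> g (i + step d) - g i != 0) /\
  (forall i, face_in D i ->
    [/\ alpha i (vj i) = alpha (vl i) (vk i),
        alpha i (vl i) = alpha (vj i) (vk i),
        cross_ratio (g i) (g (vj i)) (g (vk i)) (g (vl i)) =
          (alpha i (vj i) / alpha i (vl i))%:C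
      & alpha i (vj i) / alpha i (vl i) < 0]).

Definition weierstrass_vector (R : realType) (a b : R[i]) : 'rV[R]_3 :=
  \row_(k < 3) [:: real_part ((1 + b * a) / (b - a));
                   real_part ('i * (1 - b * a) / (b - a));
                   real_part (- ((b + a) / (b - a)))]`_k.

Definition discrete_maximal_surface (R : realType) (D : set lattice)
    (alpha : lattice -> lattice -> R) (g : lattice -> R[i])
    (f : lattice -> 'rV[R]_3) : Prop :=
  discrete_holomorphic D alpha g /\
  (forall d i, edge_in D d i ->
    f (i + step d) - f i =
      (alpha i (i + step d) / 2) *: weierstrass_vector (g i) (g (i + step d))).

(* At a point where |g| = 1 the formula has a zero denominator and the
   principal curvature is infinite; division by 0 gives the value 0 there, so
   that such (singular) vertices satisfy the inequality in [fps_along]. *)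
Definition kappa (R : realType) (alpha : lattice -> lattice -> R)
    (g : lattice -> R[i]) (i j : lattice) : R :=
  - ((4 * modulus (g j - g i) ^+ 2) /
     (alpha i j * (1 - modulus (g i) ^+ 2) * (1 - modulus (g j) ^+ 2))).

Definition fps_along (R : realType) (alpha : lattice -> lattice -> R)
    (g : lattice -> R[i]) (d : direction) (p : lattice) : Prop :=
  kappa alpha g (p - step d) p * kappa alpha g p (p + step d) <= 0.

Definition fps_vertex (R : realType) (alpha : lattice -> lattice -> R)
    (g : lattice -> R[i]) (p : lattice) : Prop :=
  fps_along alpha g Horizontal p \/ fps_along alpha g Vertical p.

Definition singular_face (R : realType) (f : lattice -> 'rV[R]_3)
    (i : lattice) : Prop :=
  exists P : plane R, ~ spacelike_plane P /\
    [/\ on_plane P (f i), on_plane P (f (vj i)),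
        on_plane P (f (vk i)) & on_plane P (f (vl i))].

(* The two faces having the segment (i, i + step d) as an edge are, by their
   lower left vertices, i and i - step (transverse d). *)
Definition adjacent_faces_in (D : set lattice) (d : direction) (i : lattice) :
    Prop :=
  face_in D i /\ face_in D (i - step (transverse d)).

Definition adjacent_faces_singular (R : realType) (f : lattice -> 'rV[R]_3)
    (d : direction) (i : lattice) : Prop :=
  singular_face f i /\ singular_face f (i - step (transverse d)).

(* Main.v *)
Require Import Defs.
From mathcomp Require Import all_boot all_order all_algebra.
From mathcomp Require Import classical_sets reals.
From mathcomp Require Import complex ring lra.

Import Order.TTheory GRing.Theory Num.Theory.

Local Open Scope ring_scope.

(** The edges p_- p and p p_+ have factors alpha of the same sign: a face beside
p_- p and the next one, beside p p_+, share a transverse edge, and a negative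
cross ratio means that the factors of both edges are opposite in sign to the
factor of that shared edge. So a nonpositive product of curvatures means that,
on p_- p or on p p_+, the values of g at the two ends lie in opposite closed
sides of the unit circle (lemma crossing_of_fps; a value on the unit circle
belongs to both sides).

It remains to see that a face with such a pair of g-values is singular. The
cross ratio being real, its four g-values lie on a circle or line
   A |z|^2 + 2 (p Re z + q Im z) + C = 0
where p now denotes a real coefficient (lemma concyclic_of_cross_ratio), and
every edge of the face is then orthogonal to N = (p, q, (A + C) / 2) in
Minkowski space (lemma weierstrass_orthogonal).
Conceptually, circles are the vectors of R^{3,1} and N is the projection of
this circle along the vector representing the unit circle, so that N fails to
be timelike as soon as the circle meets the unit circle. This is the case here
since the circle has points on both sides (lemma gcircle_normal_nontimelike).
When N = 0 the circle is the unit circle itself; the face then degenerates to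
a point, which lies in planes of any causal type (lemma nontimelike_normal).

The edge that crosses the unit circle belongs to both faces adjacent to it, so
these become singular together. *)

(** * Generalized circles *)

(** The coefficient A may vanish, so that lines are included. *)
Definition on_gcircle {R : realType} (A p q C : R) (z : R[i]) : Prop :=
  A * modulus z ^+ 2 + 2 * (p * complex.Re z + q * complex.Im z) + C = 0.

Lemma sqr_modulus (R : realType) (z : R[i]) :
  modulus z ^+ 2 = complex.Re z ^+ 2 + complex.Im z ^+ 2.
Proof. by case: z => x y /=; rewrite sqr_sqrtr // addr_ge0 ?sqr_ge0. Qed.

Lemma sqr_modulus_gt0 (R : realType) (z : R[i]) : z != 0 -> 0 < modulus z ^+ 2.
Proof.
move=> z0; rewrite lt_def sqr_ge0 andbT sqrf_eq0.
by apply: contra z0 => /eqP/ComplexField.Normc.eq0_normc ->.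
Qed.

(** Three points determine a generalized circle, and a real cross ratio puts
the fourth point on it. Negativity of the ratio ensures that a, b and c are
distinct, hence that the equation written down is not trivial. *)
Lemma concyclic_of_cross_ratio (R : realType) (a b c d : R[i]) (r : R) :
    cross_ratio a b c d = r%:C%C -> r < 0 ->
  exists A p q C : R, [|| A != 0, p != 0 | q != 0] /\
    [/\ on_gcircle A p q C a, on_gcircle A p q C b,
        on_gcircle A p q C c & on_gcircle A p q C d].
Proof.
move=> cr r_lt0.
have r_neq0 : r%:C%C != 0 :> R[i] by rewrite fmorph_eq0 lt_eqF.
have den_neq0 : (b - c) * (d - a) != 0.
  apply: contra_neq r_neq0 => den0.
  by rewrite -cr /cross_ratio den0 invr0 mulr0.
have num_neq0 : (a - b) * (c - d) != 0.
  by apply: contra_neq r_neq0 => num0; rewrite -cr /cross_ratio num0 mul0r.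
(* The cross ratio of a, b, a, d is 1. *)
have ac : a != c.
  apply/eqP => ac; move: cr den_neq0; rewrite /cross_ratio -ac.
  rewrite [(b - a) * _](_ : _ = (a - b) * (a - d)); last by ring.
  move=> cr n0; move: cr; rewrite divff // => /(congr1 (@complex.Re R)) /= r1.
  by move: r_lt0; rewrite -r1 ltr10.
have ab : a - b != 0 by move: num_neq0; rewrite mulf_eq0 => /norP[].
have bc : b - c != 0 by move: den_neq0; rewrite mulf_eq0 => /norP[].
have {cr} : (a - b) * (c - d) = r%:C%C * ((b - c) * (d - a)).
  by rewrite -cr /cross_ratio divfK.
case: a b c d ac ab bc {r_neq0 den_neq0 num_neq0} =>
  [a1 a2] [b1 b2] [c1 c2] [d1 d2] ac ab bc [crR crI].
(* With k = (a - b) conj (b - c), the circle through a, b, c is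
   Im (k (c - z) conj (z - a)) = 0; the coefficients below come from the
   expansion of twice the left-hand side. *)
pose kR := (a1 - b1) * (b1 - c1) + (a2 - b2) * (b2 - c2).
pose kI := (a2 - b2) * (b1 - c1) - (a1 - b1) * (b2 - c2).
exists (- (2 * kI)), (kI * (a1 + c1) + kR * (c2 - a2)),
  (kI * (a2 + c2) + kR * (a1 - c1)),
  (- (2 * (kR * (c2 * a1 - c1 * a2) + kI * (c1 * a1 + c2 * a2)))).
rewrite /on_gcircle !sqr_modulus /=; split; last first.
  split; rewrite /kR /kI; [ring|ring|ring|].
  (* At z = d, this is the imaginary part of num * conj den, where num / den is
     the cross ratio. *)
  transitivity (2 * (
    ((a1 - b1) * (c2 - d2) + (a2 - b2) * (c1 - d1)) *
      ((b1 - c1) * (d1 - a1) - (b2 - c2) * (d2 - a2)) -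
    ((a1 - b1) * (c1 - d1) - (a2 - b2) * (c2 - d2)) *
      ((b1 - c1) * (d2 - a2) + (b2 - c2) * (d1 - a1)))).
    by ring.
  by rewrite crR crI; ring.
apply/negPn/negP; rewrite !negb_or !negbK oppr_eq0 mulf_eq0 pnatr_eq0 /=.
move=> /and3P[/eqP kI0]; rewrite kI0 !mul0r !add0r.
have kR_neq0 : kR != 0.
  have := mulf_neq0 (lt0r_neq0 (sqr_modulus_gt0 _ _ ab))
    (lt0r_neq0 (sqr_modulus_gt0 _ _ bc)).
  rewrite !sqr_modulus /= (_ : _ * _ = kR ^+ 2 + kI ^+ 2).
    by rewrite kI0 expr0n addr0 expf_eq0.
  by rewrite /kR /kI; ring.
rewrite !mulf_eq0 (negPf kR_neq0) /= !subr_eq0 => /eqP e2 /eqP e1.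
by move: ac; rewrite e1 e2 eqxx.
Qed.

(** * The normal of a face *)

Definition gcircle_normal {R : realType} (A p q C : R) : 'rV[R]_3 :=
  \row_(k < 3) [:: p; q; (A + C) / 2]`_k.

(** Multiplying numerators and denominators by conj (b - a) makes the real
parts polynomial. In this form the equation of a circle through a and b can be
substituted, and the vector visibly vanishes when |a| = |b| = 1. *)
Lemma weierstrass_vectorE (R : realType) (a b : R[i]) : b - a != 0 ->
  weierstrass_vector a b = (modulus (b - a) ^+ 2)^-1 *:
    \row_(k < 3) [::
      complex.Re b * (1 - modulus a ^+ 2) - complex.Re a * (1 - modulus b ^+ 2);
      complex.Im b * (1 - modulus a ^+ 2) - complex.Im a * (1 - modulus b ^+ 2);
      modulus a ^+ 2 - modulus b ^+ 2]`_k.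
Proof.
move=> /sqr_modulus_gt0/lt0r_neq0; rewrite !sqr_modulus => ba.
apply/rowP => k; rewrite !mxE -complexiE.
case: a b ba => [a1 a2] [b1 b2] /= ba.
by case: k => [[|[|[|//]]] lt_k3] /=; field.
Qed.

Lemma minkowskiZl (R : realType) (t : R) (u v : 'rV[R]_3) :
  minkowski (t *: u) v = t * minkowski u v.
Proof. by rewrite /minkowski !mxE; ring. Qed.

Lemma minkowskiBl (R : realType) (u u' v : 'rV[R]_3) :
  minkowski (u - u') v = minkowski u v - minkowski u' v.
Proof. by rewrite /minkowski !mxE; ring. Qed.

(** The equations of the circle at a and b express p Re + q Im as an affine
function of the squared modulus; after this substitution the product vanishes
identically. *)
Lemma weierstrass_orthogonal (R : realType) (A p q C : R) (a b : R[i]) :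
    b - a != 0 -> on_gcircle A p q C a -> on_gcircle A p q C b ->
  minkowski (weierstrass_vector a b) (gcircle_normal A p q C) = 0.
Proof.
move=> ba ha hb; rewrite weierstrass_vectorE // minkowskiZl.
rewrite /minkowski !mxE /=; move: ha hb; rewrite /on_gcircle.
set u := modulus a ^+ 2; set w := modulus b ^+ 2 => ha hb.
rewrite [X in _ * X](_ : _ = 0) ?mulr0 //.
transitivity ((p * complex.Re b + q * complex.Im b) * (1 - u)
  - (p * complex.Re a + q * complex.Im a) * (1 - w) - (u - w) * ((A + C) / 2)).
  by ring.
rewrite (_ : p * complex.Re b + _ = - (A * w + C) / 2); last by lra.
rewrite (_ : p * complex.Re a + _ = - (A * u + C) / 2); last by lra.
by ring.
Qed.

(** On the circle, t = |z|^2 satisfies F t <= 0 for the quadratic function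
F t = (A t + C)^2 - 4 (p^2 + q^2) t. This function is convex, and t takes values
on both sides of 1, so F 1 <= 0; but F 1 is -4 times the Minkowski square of the
normal. *)
Lemma gcircle_normal_nontimelike (R : realType) (A p q C : R) (a b : R[i]) :
    on_gcircle A p q C a -> on_gcircle A p q C b ->
    (1 - modulus a ^+ 2) * (1 - modulus b ^+ 2) <= 0 ->
  ~ timelike (gcircle_normal A p q C).
Proof.
(* This is the Cauchy-Schwarz inequality for (p, q) and (Re z, Im z). *)
have F_le0 z : on_gcircle A p q C z ->
    (A * modulus z ^+ 2 + C) ^+ 2 <= 4 * (p ^+ 2 + q ^+ 2) * modulus z ^+ 2.
  rewrite /on_gcircle => hz.
  rewrite (_ : A * _ + C = - (2 * (p * complex.Re z + q * complex.Im z))).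
    rewrite sqr_modulus.
    have := sqr_ge0 (p * complex.Im z - q * complex.Re z); nra.
  by apply/eqP; rewrite -subr_eq0 opprK -hz; apply/eqP; ring.
move=> /F_le0 Fa /F_le0 Fb; rewrite /timelike /minkowski !mxE /=.
move: Fa Fb; set u := modulus a ^+ 2; set w := modulus b ^+ 2.
have F1_le0 (s t : R) : s <= 1 <= t ->
    (A * s + C) ^+ 2 <= 4 * (p ^+ 2 + q ^+ 2) * s ->
    (A * t + C) ^+ 2 <= 4 * (p ^+ 2 + q ^+ 2) * t ->
  (A + C) ^+ 2 <= 4 * (p ^+ 2 + q ^+ 2).
  move=> /andP[s1 t1] Fs Ft.
  have [ts|st] := leP t s.
    have s_eq1 : s = 1 by lra.
    by rewrite s_eq1 !mulr1 in Fs.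
  (* Convexity: (t - s) F 1 = (t - 1) F s + (1 - s) F t minus the nonnegative
     term A^2 (t - 1) (1 - s) (t - s). *)
  set K := leRHS; rewrite -subr_ge0.
  rewrite -(pmulr_rge0 _ (_ : 0 < t - s)); last by rewrite subr_gt0.
  have h1 : 0 <= (t - 1) * (K * s - (A * s + C) ^+ 2).
    by apply: mulr_ge0; rewrite subr_ge0.
  have h2 : 0 <= (1 - s) * (K * t - (A * t + C) ^+ 2).
    by apply: mulr_ge0; rewrite subr_ge0.
  have h3 : 0 <= A ^+ 2 * ((t - 1) * (1 - s) * (t - s)).
    apply: mulr_ge0; first exact: sqr_ge0.
    by rewrite !mulr_ge0 // subr_ge0 // ltW.
  rewrite (_ : _ * _ = (t - 1) * (K * s - (A * s + C) ^+ 2) +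
    (1 - s) * (K * t - (A * t + C) ^+ 2) +
    A ^+ 2 * ((t - 1) * (1 - s) * (t - s))).
    by apply: addr_ge0 => //; apply: addr_ge0.
  by ring.
move=> Fu Fw uw N_lt0; suff: (A + C) ^+ 2 <= 4 * (p ^+ 2 + q ^+ 2) by nra.
have [u1|u1] := ltP u 1; have [w1|w1] := ltP w 1.
- by move: uw; rewrite leNgt mulr_gt0 ?subr_gt0.
- by apply: (F1_le0 u w); rewrite // w1 andbT ltW.
- by apply: (F1_le0 w u); rewrite // u1 andbT ltW.
- have /eqP : (1 - u) * (1 - w) = 0.
    by apply: le_anti; rewrite uw mulr_le0 ?subr_le0.
  rewrite mulf_eq0 !subr_eq0 => /orP[] /eqP eq1.
    by move: Fu; rewrite -eq1 !mulr1.
  by move: Fw; rewrite -eq1 !mulr1.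
Qed.

(** The vector gcircle_normal serves unless it is 0. In that case the circle is
the unit circle, where all Weierstrass vectors vanish, and any vector that is
not timelike will do. *)
Lemma nontimelike_normal (R : realType) (A p q C : R) (a b : R[i]) :
    [|| A != 0, p != 0 | q != 0] ->
    on_gcircle A p q C a -> on_gcircle A p q C b ->
    (1 - modulus a ^+ 2) * (1 - modulus b ^+ 2) <= 0 ->
  exists2 N : 'rV[R]_3, N != 0 /\ ~ timelike N &
    forall z w : R[i], w - z != 0 ->
      on_gcircle A p q C z -> on_gcircle A p q C w ->
    minkowski (weierstrass_vector z w) N = 0.
Proof.
move=> circ_neq0 ha hb ab.
have [N0|N_neq0] := eqVneq (gcircle_normal A p q C) 0.
  have p0 : p = 0 by have /rowP/(_ 0) := N0; rewrite !mxE.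
  have q0 : q = 0 by have /rowP/(_ 1) := N0; rewrite !mxE.
  have AC : A + C = 0 by have /rowP/(_ 2) := N0; rewrite !mxE /=; lra.
  have A_neq0 : A != 0 by move: circ_neq0; rewrite p0 q0 eqxx !orbF.
  have on_unit z : on_gcircle A p q C z -> modulus z ^+ 2 = 1.
    rewrite /on_gcircle p0 q0 !mul0r addr0 mulr0 addr0 => hz.
    by apply: (mulfI A_neq0); lra.
  exists (\row_(k < 3) (k == 0)%:R).
    split; last by rewrite /timelike /minkowski !mxE /=; lra.
    by apply/eqP => /rowP/(_ 0); rewrite !mxE /=; lra.
  move=> z w wz /on_unit z1 /on_unit w1; rewrite weierstrass_vectorE // z1 w1.
  by rewrite minkowskiZl /minkowski !mxE /=; ring.
exists (gcircle_normal A p q C).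
  by split=> //; apply: gcircle_normal_nontimelike ha hb ab.
by move=> z w; apply: weierstrass_orthogonal.
Qed.

(** The two g-values on opposite sides of the unit circle may sit at any two
vertices: only the circle through all four values matters. *)
Lemma singular_face_of_crossing (R : realType) (D : set lattice)
    (alpha : lattice -> lattice -> R) (g : lattice -> R[i])
    (f : lattice -> 'rV[R]_3) (i : lattice) (z w : R[i]) :
    discrete_maximal_surface D alpha g f -> face_in D i ->
    z \in [:: g i; g (vj i); g (vk i); g (vl i)] ->
    w \in [:: g i; g (vj i); g (vk i); g (vl i)] ->
    (1 - modulus z ^+ 2) * (1 - modulus w ^+ 2) <= 0 ->
  singular_face f i.
Proof.
move=> [[g_edge g_face] f_edge] Di zi wi zw.
have [_ _ cr r_lt0] := g_face i Di.
have [A [p [q [C [circ_neq0 [ci cj ck cl]]]]]] :=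
  concyclic_of_cross_ratio _ _ _ _ _ _ cr r_lt0.
have on_circ x : x \in [:: g i; g (vj i); g (vk i); g (vl i)] ->
    on_gcircle A p q C x.
  by rewrite !inE => /or4P[] /eqP->.
have [N [N_neq0 Ntime] orth] :=
  nontimelike_normal _ _ _ _ _ _ _ circ_neq0 (on_circ z zi) (on_circ w wi) zw.
have [Di0 Dj Dk Dl] := Di.
have same_level d x : edge_in D d x -> on_gcircle A p q C (g x) ->
    on_gcircle A p q C (g (x + step d)) ->
  minkowski (f (x + step d)) N = minkowski (f x) N.
  move=> Dx cx cy; apply/eqP; rewrite -subr_eq0 -minkowskiBl f_edge //.
  by rewrite minkowskiZl orth ?mulr0 ?g_edge.
exists (Plane (minkowski (f i) N) N_neq0); split=> //; rewrite /on_plane /=.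
have hj : minkowski (f (vj i)) N = minkowski (f i) N by apply: same_level.
split=> //; last exact: same_level.
by rewrite -hj; apply: same_level.
Qed.

(** * Curvatures and the unit circle *)

(** Up to positive factors, the product of the two curvatures is the inverse of
alpha_- alpha_+ (P Q) (Q S), where P, Q, S are the values of 1 - |g|^2 at the
three vertices. Since alpha_- alpha_+ > 0, the factors P Q and Q S cannot both
be positive. *)
Lemma crossing_of_fps (R : realType) (D : set lattice)
    (alpha : lattice -> lattice -> R) (g : lattice -> R[i]) (d : direction)
    (x : lattice) :
    discrete_holomorphic D alpha g ->
    face_in D x -> face_in D (x + step d) -> fps_along alpha g d (x + step d) ->
  (1 - modulus (g x) ^+ 2) * (1 - modulus (g (x + step d)) ^+ 2) <= 0 \/
  (1 - modulus (g (x + step d)) ^+ 2) *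
    (1 - modulus (g (x + step d + step d)) ^+ 2) <= 0.
Proof.
move=> [g_edge g_face] Dx Dy.
set y := x + step d.
have Dxy : edge_in D d x.
  by case: Dx; rewrite /vj /vl /edge_in; case: (d).
have Dyz : edge_in D d y.
  by case: Dy; rewrite /vj /vl /edge_in /y; case: (d).
rewrite /fps_along addrK => fps.
(* Both edges are compared with the transverse edge that the two faces share. *)
have alpha_gt0 : 0 < alpha x y * alpha y (y + step d).
  have [x1 x2 _ rx] := g_face x Dx; have [y1 y2 _ ry] := g_face y Dy.
  have sg (s t : R) : s / t < 0 -> s * t < 0.
    have [->|t_neq0] := eqVneq t 0; first by rewrite invr0 mulr0 ltxx.
    rewrite (_ : s * t = s / t * t ^+ 2); last by field.
    by move=> st; rewrite pmulr_llt0 ?st ?exprn_even_gt0.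
  have same_sign (s t u : R) : s * u < 0 -> t * u < 0 -> 0 < s * t.
    move=> su tu.
    have : 0 < (s * u) * (t * u) by rewrite nmulr_rgt0.
    rewrite mulrACA pmulr_lgt0 // -expr2 exprn_even_gt0 //=.
    by apply: contraTneq su => ->; rewrite mulr0 ltxx.
  move/sg: rx; move/sg: ry.
  move: x1 x2 y1 y2; rewrite /y /vj /vk /vl.
  case: (d) => /= x1 x2 y1 y2.
    by rewrite x2 => ry rx; apply: same_sign rx ry.
  rewrite x1 addrAC mulrC => rx.
  by rewrite mulrC => ry; apply: same_sign ry rx.
have gxy : 0 < modulus (g y - g x) ^+ 2 by apply/sqr_modulus_gt0/g_edge.
have gyz : 0 < modulus (g (y + step d) - g y) ^+ 2.
  by apply/sqr_modulus_gt0/g_edge.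
move: fps alpha_gt0 gxy gyz; rewrite /kappa.
set P := 1 - modulus (g x) ^+ 2; set Q := 1 - modulus (g y) ^+ 2.
set S := 1 - modulus (g (y + step d)) ^+ 2.
move: (alpha x y) (alpha y _) => s t fps st m_gt0 m'_gt0.
have [|PQ] := leP (P * Q) 0; first by left.
have [|QS] := leP (Q * S) 0; first by right.
move: fps; rewrite mulrNN mulf_div leNgt divr_gt0 //.
  by do 2!apply: mulr_gt0 => //; rewrite ltr0n.
rewrite (_ : s * P * Q * (t * Q * S) = s * t * (P * Q) * (Q * S)); last by ring.
by apply: mulr_gt0 QS; apply: mulr_gt0 PQ.
Qed.

(* The three consecutive vertices follow a direction d in which the FPS
   inequality holds at p. *)
Theorem theorem8p1 (R : realType) (D : set lattice)
    (alpha : lattice -> lattice -> R) (g : lattice -> R[i])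
    (f : lattice -> 'rV[R]_3)
    (hf : discrete_maximal_surface D alpha g f)
    (d : direction) (pm p pp : lattice)
    (hpm : p = pm + step d) (hpp : pp = p + step d)
    (hDm : adjacent_faces_in D d pm) (hDp : adjacent_faces_in D d p)
    (hfps : fps_vertex alpha g p) (hd : fps_along alpha g d p) :
  adjacent_faces_singular f d pm \/ adjacent_faces_singular f d p.
Proof.
(* The edge starts at the lower left vertex of one of its adjacent faces, and
   avoids the lower left vertex of the other one. *)
have edge_singular x : adjacent_faces_in D d x ->
    (1 - modulus (g x) ^+ 2) * (1 - modulus (g (x + step d)) ^+ 2) <= 0 ->
  adjacent_faces_singular f d x.
  move=> [Dx Dx'] crossing; split.
    apply: (singular_face_of_crossing _ _ _ _ _ _ _ _ hf Dx _ _ crossing).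
      by rewrite mem_head.
    by rewrite !inE /vj /vl; case: (d); rewrite eqxx ?orbT.
  have x_eq : x = x - step (transverse d) + step (transverse d).
    by rewrite subrK.
  apply: (singular_face_of_crossing _ _ _ _ _ _ _ _ hf Dx' _ _ crossing).
    by rewrite !inE /vj /vl {1 3 5 7}x_eq; case: (d); rewrite eqxx ?orbT.
  rewrite !inE /vk; case: (d); rewrite /= ?subrK ?eqxx ?orbT //.
  by rewrite addrAC subrK eqxx ?orbT.
subst p; have [Dm _] := hDm; have [Dp _] := hDp.
have [cross|cross] := crossing_of_fps _ _ _ _ _ _ hf.1 Dm Dp hd.
  by left; apply: edge_singular.
by right; apply: edge_singular.
Qed.
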